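(* Let $\beta\in\mathbb{R}$ and $\mathbf{z}\in K_{\exp}^*$ with $z_x<0$ such that $\mathcal{F}_\beta=\{\mathbf{z}\}^\perp\cap K_{\exp}$ is a one-dimensional face of $K_{\exp}$. For $t\ge0$ let $\kappa_{\mathbf{z},t}:=\max\{2t^{1/2},2\gamma_{\mathbf{z},t}^{-1}\}$, where $$\gamma_{\mathbf{z},t}:=\inf_{\mathbf{v}}\left\{\frac{\|\mathbf{w}-\mathbf{v}\|^{1/2}}{\|\mathbf{w}-\mathbf{u}\|}\;\Big|\;\mathbf{v}\in\partial K_{\exp}\cap B(t)\setminus\mathcal{F}_\beta,\ \mathbf{w}=P_{\{\mathbf{z}\}^\perp}\mathbf{v},\ \mathbf{u}=P_{\mathcal{F}_\beta}\mathbf{w},\ \mathbf{w}\ne\mathbf{u}\right\}.$$ Then the function $\psi_{\mathcal{K},\mathbf{z}}:\mathbb{R}_+\times\mathbb{R}_+\to\mathbb{R}_+$ given by $$\psi_{\mathcal{K},\mathbf{z}}(\epsilon,t):=\max\{\epsilon,\epsilon/\|\mathbf{z}\|\}+\kappa_{\mathbf{z},t}(\epsilon+\max\{\epsilon,\epsilon/\|\mathbf{z}\|\})^{1/2}$$ is a one-step facial residual function for $K_{\exp}$ and $\mathbf{z}$. In particular, there exist $\kappa>0$ and a nonnegative monotone nondecreasing function $\rho:\mathbb{R}_+\to\mathbb{R}_+$ such that the function $\hat\psi_{\mathcal{K},\mathbf{z}}(\epsilon,t):=\kappa\epsilon+\rho(t)\sqrt{\epsilon}$ is a one-step facial residual function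 for $K_{\exp}$ and $\mathbf{z}$.
   Context: $\mathbb{R}^3$ carries the standard inner product and Euclidean norm; vectors are written $\mathbf{p}=(p_x,p_y,p_z)$; $\mathbb{R}_+=[0,\infty)$. $K_{\exp}=\{(x,y,z):y>0,\ z\ge ye^{x/y}\}\cup\{(x,y,z):x\le0,\ z\ge0,\ y=0\}$ is the exponential cone, $K_{\exp}^*$ its dual cone, $\partial K_{\exp}$ its boundary, and $\mathcal{F}_\beta=\{(-\beta y+y,y,e^{1-\beta}y):y\ge0\}$. $B(t)$ is the closed ball of radius $t$ centered at the origin and $P_C$ is the orthogonal projection onto $C$. The infimum over the empty set is $+\infty$ and $1/\infty=0$. One-step facial residual function for a closed convex cone $\mathcal{K}$ and $\mathbf{z}\in\mathcal{K}^*$: a function $\psi:\mathbb{R}_+\times\mathbb{R}_+\to\mathbb{R}_+$ that is monotone nondecreasing in each argument, satisfies $\psi(0,t)=0$ for all $t$, and is such that for every $\mathbf{x}\in\mathrm{span}\,\mathcal{K}$ and $\epsilon\ge0$, $\mathrm{d}(\mathbf{x},\mathcal{K})\le\epsilon$ and $\langle\mathbf{x},\mathbf{z}\rangle\le\epsilon$ imply $\mathrm{d}(\mathbf{x},\mathcal{K}\cap\{\mathbf{z}\}^\perp)\le\psi(\epsilon,\|\mathbf{x}\|)$, where $\mathrm{d}(\cdot,C)$ is the distance to $C$. *)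

(* Defs.v *)
From HB Require Import structures.
From mathcomp Require Export all_boot all_order all_algebra.
From mathcomp Require Export all_classical all_reals all_analysis.
Export Order.TTheory GRing.Theory Num.Theory.
Export numFieldNormedType.Exports.

Set Implicit Arguments.
Unset Strict Implicit.
Unset Printing Implicit Defensive.

Local Open Scope classical_set_scope.
Local Open Scope ring_scope.

Section Euclidean.
Variables (R : realType) (n : nat).
Implicit Types (x y z p : 'rV[R]_n) (C : set 'rV[R]_n).

Definition dotp x y : R := \sum_(i < n) x 0 i * y 0 i.

(* The library norm `|x| on row vectors is the sup norm; only its topology is
   used here (in closed, closure and interior), and it is the Euclidean one. *)
Definition enorm x : R := Num.sqrt (dotp x x).

(* +oo when C is empty *)
Definition dist x C : \bar R := ereal_inf [set (enorm (x - y))%:E | y in C].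

(* p is a nearest point of C to x; it is unique when C is closed and convex. *)
Definition is_proj C x p := C p /\ (forall y, C y -> enorm (x - p) <= enorm (x - y)).

Definition perp z : set 'rV[R]_n := [set x | dotp x z = 0].

Definition dual_cone C : set 'rV[R]_n := [set z | forall x, C x -> 0 <= dotp x z].

Definition boundary C : set 'rV[R]_n := closure C `\` C°.

Definition closed_ball0 (t : R) : set 'rV[R]_n := [set x | enorm x <= t].

Definition lin_span C : set 'rV[R]_n :=
  [set x | exists2 s : seq 'rV[R]_n,
    (forall y, y \in s -> C y) & x \in << s >>%VS].

Definition has_dim C (d : nat) :=
  exists2 U : {vspace 'rV[R]_n}, lin_span C = [set` U] & \dim U = d.

Definition closed_convex_cone C :=
  [/\ closed C, C !=set0, @convex_set R _ C
    & forall (a : R) x, 0 <= a -> C x -> C (a *: x)].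

Definition is_face K F :=
  [/\ closed_convex_cone F, F `<=` K
    & forall x y, K x -> K y -> F (x + y) -> F x /\ F y].

(* A function on nonnegative reals is a total function on R whose values at
   negative arguments are irrelevant: only nonnegative arguments are
   constrained, and nonnegativity of the values is part of the definition. *)
Definition one_step_FRF (K : set 'rV[R]_n) z (psi : R -> R -> R) :=
  [/\ forall e t, 0 <= e -> 0 <= t -> 0 <= psi e t,
      forall e1 e2 t, 0 <= e1 -> e1 <= e2 -> 0 <= t -> psi e1 t <= psi e2 t,
      forall e t1 t2, 0 <= e -> 0 <= t1 -> t1 <= t2 -> psi e t1 <= psi e t2,
      forall t, 0 <= t -> psi 0 t = 0
    & forall x e, lin_span K x -> 0 <= e ->
        (dist x K <= e%:E)%E -> dotp x z <= e ->
        (dist x (K `&` perp z) <= (psi e (enorm x))%:E)%E].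

End Euclidean.

Section ExponentialCone.
Variable R : realType.
Implicit Types (z v w u : 'rV[R]_3) (beta t : R).

Definition vec3 (a b c : R) : 'rV[R]_3 := \row_(i < 3) [:: a; b; c]`_i.

Definition Kexp : set 'rV[R]_3 :=
  [set v | let x := v 0 0 in let y := v 0 1 in let z := v 0 2 in
     (0 < y /\ y * expR (x / y) <= z) \/ [/\ x <= 0, 0 <= z & y = 0]].

Definition Fbeta beta : set 'rV[R]_3 :=
  [set vec3 (- beta * y + y) y (expR (1 - beta) * y) | y in [set y | 0 <= y]].

Definition gamma beta z t : \bar R :=
  ereal_inf [set r | exists v w u,
    [/\ ((boundary Kexp `&` closed_ball0 t) `\` Fbeta beta) v,
        is_proj (perp z) v w,
        is_proj (Fbeta beta) w u,
        w != u
      & r = (Num.sqrt (enorm (w - v)) / enorm (w - u))%:E]].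

(* In \bar R the library sets +oo^-1 = 0 and 0^-1 = +oo. *)
Definition kappa beta z t : \bar R :=
  maxe (2 * Num.sqrt t)%:E (2%:E * (gamma beta z t)^-1)%E.

(* fine is the identity on finite values and sends +oo to 0, so this formula is
   meaningful only where kappa is finite. *)
Definition psiK beta z (e t : R) : R :=
  Num.max e (e / enorm z)
  + fine (kappa beta z t) * Num.sqrt (e + Num.max e (e / enorm z)).

End ExponentialCone.

Arguments Kexp R : clear implicits.

(* Main.v *)
(** Since z exposes the ray spanned by f = (1 - beta, 1, e^(1 - beta)), it is a
    positive multiple of (-1, -beta, e^(beta - 1)).  For v = (x, y, y e^(x/y))
    and h = x/y - (1 - beta), this normal pairs with v to y (e^h - 1 - h), while
    v - y f = y (h, 0, e^(1 - beta) (e^h - 1)).  The bounds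
    (e^h - 1)^2 <= 2 (1 + e^h) (e^h - 1 - h) and
    h^2 <= 16 (1 + |h|) (e^h - 1 - h) hold for all h, and y |h| and y e^h are
    bounded on B(t), so the squared distance of v to the ray is O(<v, z>) there;
    hence gamma_(z,t) > 0.
    Given q in {z}^perp, let v be its projection on K, w the projection of v on
    {z}^perp and u that of w on the face: |q - w| and |w - v| are at most |q - v|,
    and |w - u| <= gamma^-1 |w - v|^(1/2).  A general x is first moved to
    {z}^perp, at cost max(e, e/|z|). *)
Require Import Defs.
From mathcomp Require Import ring lra.

Set Implicit Arguments.
Unset Strict Implicit.
Unset Printing Implicit Defensive.

Local Open Scope classical_set_scope.
Local Open Scope ring_scope.

(** * Euclidean inner product, norm and nearest points *)

Section EuclideanTheory.
Variables (R : realType) (n : nat).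
Implicit Types (x y z p : 'rV[R]_n) (C : set 'rV[R]_n).

Lemma dotpC x y : dotp x y = dotp y x.
Proof. by apply: eq_bigr => i _; rewrite mulrC. Qed.

Lemma dotpDl x y z : dotp (x + y) z = dotp x z + dotp y z.
Proof. by rewrite -big_split; apply: eq_bigr => i _; rewrite mxE mulrDl. Qed.

Lemma dotpZl a x y : dotp (a *: x) y = a * dotp x y.
Proof. by rewrite /dotp mulr_sumr; apply: eq_bigr => i _; rewrite mxE mulrA. Qed.

Lemma dotpNl x y : dotp (- x) y = - dotp x y.
Proof. by rewrite -scaleN1r dotpZl mulN1r. Qed.

Lemma dotpDr x y z : dotp z (x + y) = dotp z x + dotp z y.
Proof. by rewrite !(dotpC z) dotpDl. Qed.

Lemma dotpZr a x y : dotp y (a *: x) = a * dotp y x.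
Proof. by rewrite !(dotpC y) dotpZl. Qed.

Lemma dotpNr x y : dotp y (- x) = - dotp y x.
Proof. by rewrite !(dotpC y) dotpNl. Qed.

Lemma dotp_ge0 x : 0 <= dotp x x.
Proof. by apply: sumr_ge0 => i _; rewrite -expr2 sqr_ge0. Qed.

Lemma enorm_ge0 x : 0 <= enorm x.
Proof. exact: sqrtr_ge0. Qed.

Lemma enorm_sqr x : enorm x ^+ 2 = dotp x x.
Proof. by rewrite sqr_sqrtr ?dotp_ge0. Qed.

Lemma dotp_eq0 x : (dotp x x == 0) = (x == 0).
Proof.
apply/eqP/eqP => [|->]; last by apply: big1 => i _; rewrite mxE mul0r.
move=> /psumr_eq0P h; apply/rowP => i; rewrite mxE; apply/eqP.
by rewrite -sqrf_eq0 expr2 h // => j _; rewrite -expr2 sqr_ge0.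
Qed.

Lemma enorm_eq0 x : (enorm x == 0) = (x == 0).
Proof. by rewrite -dotp_eq0 -enorm_sqr sqrf_eq0. Qed.

Lemma enorm_gt0 x : (0 < enorm x) = (x != 0).
Proof. by rewrite lt0r enorm_eq0 enorm_ge0 andbT. Qed.

Lemma enormZ a x : enorm (a *: x) = `|a| * enorm x.
Proof. by rewrite /enorm dotpZl dotpZr mulrA -expr2 sqrtrM ?sqr_ge0 // sqrtr_sqr. Qed.

Lemma enormN x : enorm (- x) = enorm x.
Proof. by rewrite -scaleN1r enormZ normrN1 mul1r. Qed.

Lemma enorm_distC x y : enorm (x - y) = enorm (y - x).
Proof. by rewrite -enormN opprB. Qed.

Lemma enorm_le x a : 0 <= a -> (enorm x <= a) = (dotp x x <= a ^+ 2).
Proof. by move=> a0; rewrite -enorm_sqr ler_pXn2r // ?nnegrE ?enorm_ge0. Qed.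

Lemma dotp_abs_le x y : `|dotp x y| <= enorm x * enorm y.
Proof.
have [->|y0] := eqVneq y 0.
  have -> : dotp x 0 = 0 by apply: big1 => i _; rewrite mxE mulr0.
  by rewrite normr0 mulr_ge0 ?enorm_ge0.
rewrite -(@ler_pXn2r _ 2) ?nnegrE ?mulr_ge0 ?enorm_ge0 ?normr_ge0 //.
rewrite exprMn !enorm_sqr real_normK ?num_real //.
have yy : 0 < dotp y y by rewrite lt0r dotp_eq0 y0 dotp_ge0.
(* This vector is <y,y> times the component of x orthogonal to y; its squared norm is <y,y> times
   the Cauchy-Schwarz defect. *)
have := dotp_ge0 (dotp y y *: x - dotp x y *: y).
rewrite !(dotpDl, dotpDr, dotpNl, dotpNr, dotpZl, dotpZr) (dotpC y x).
move=> h; rewrite -subr_ge0 -(pmulr_rge0 _ yy); apply: le_trans h _.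
by rewrite le_eqVlt; apply/orP; left; apply/eqP; ring.
Qed.

Lemma ler_enormD x y : enorm (x + y) <= enorm x + enorm y.
Proof.
rewrite enorm_le ?addr_ge0 ?enorm_ge0 // !(dotpDl, dotpDr) (dotpC y x).
have := dotp_abs_le x y; rewrite ler_norml => /andP[_ h].
rewrite sqrrD !enorm_sqr; lra.
Qed.

Lemma ler_enorm_dist p x y : enorm (x - y) <= enorm (x - p) + enorm (p - y).
Proof. by rewrite -(subrKA p) ler_enormD. Qed.

(** Turns Euclidean bounds into boundedness for the sup norm, hence into compactness. *)
Lemma normr_le_enorm x : `|x| <= enorm x.
Proof.
rewrite /Num.norm /= mx_normrE; apply: bigmax_le => [|[i j] _ /=]; first exact: enorm_ge0.
rewrite (ord1 i) -(@ler_pXn2r _ 2) ?nnegrE ?enorm_ge0 // real_normK ?num_real //.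
rewrite enorm_sqr /dotp (bigD1 j) //= expr2 lerDl.
by apply: sumr_ge0 => k _; rewrite -expr2 sqr_ge0.
Qed.

Lemma coord_le_enorm x i : `|x 0 i| <= enorm x.
Proof.
rewrite -(@ler_pXn2r _ 2) ?nnegrE ?enorm_ge0 // real_normK ?num_real //.
rewrite enorm_sqr /dotp (bigD1 i) //= expr2 lerDl.
by apply: sumr_ge0 => k _; rewrite -expr2 sqr_ge0.
Qed.

Lemma enorm_continuous : continuous (@enorm R n).
Proof.
move=> x; have dc : continuous (fun y : 'rV[R]_n => dotp y y).
  rewrite /dotp; apply: continuous_big => [|i _ y]; first exact: add_continuous.
  by apply: continuousM; exact: coord_continuous.
by apply: (continuous_comp (dc x)); exact: sqrt_continuous.
Qed.

(** Only the points of C no farther from x than a fixed c in C compete, and they form a compact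
    set. *)
Lemma nearest_point C x : closed C -> C !=set0 -> exists p, is_proj C x p.
Proof.
move=> Ccl [c Cc].
pose f y := enorm (x - y).
have fc : continuous f.
  have sc : continuous (fun y : 'rV[R]_n => x - y).
    by move=> y; apply: continuousB; [exact: cst_continuous|move=> ?].
  by move=> y; apply: (continuous_comp (sc y)); exact: enorm_continuous.
pose A := C `&` [set y | f y <= f c].
have Acl : closed A.
  apply: closedI => //; apply: (preimage_closed _ (@closed_le _ (f c))) => y _.
  exact: fc.
have Abd : bounded_set A.
  exists (`|x| + f c); split; first exact: num_real.
  move=> M /ltW hM y [_ /= hy]; apply: le_trans hM.
  rewrite -[y](subKr x) (le_trans (ler_normB _ _)) // lerD2l.
  exact: le_trans (normr_le_enorm _) hy.
have A0 : A !=set0 by exists c; split => //=.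
have [p pA hp] := EVT_min_rV A0 (bounded_closed_compact Abd Acl) (continuous_subspaceT fc).
move: pA; rewrite inE => -[Cp /= pc]; exists p; split => // y Cy.
have [yc|/ltW cy] := leP (f y) (f c).
  by apply: hp; rewrite inE; split.
exact: le_trans pc cy.
Qed.

(** From an interior point p, a small step towards x would stay in C and come strictly closer to
    x. *)
Lemma is_proj_boundary C x p : is_proj C x p -> ~ C x -> boundary C p.
Proof.
move=> [Cp hp] nCx; split; first exact: subset_closure.
move=> pint.
have xp : x != p by apply: contra_notN nCx => /eqP ->.
pose g (s : R) := p + s *: (x - p).
have gc : {for 0, continuous g}.
  by apply: cvgD; [exact: cvg_cst|apply: cvgZr_tmp; exact: cvg_id].
have : nbhs (g 0) C by rewrite /g scale0r addr0.
move=> /gc /nbhs_ballP[e /= e0 he].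
pose s := Num.min (e / 2) (1 / 2).
have s0 : 0 < s by rewrite lt_min; apply/andP; split; lra.
have s1 : s <= 1 / 2 by rewrite ge_min lexx orbT.
have se : s <= e / 2 by rewrite ge_min lexx.
have : C (g s) by apply: he; rewrite /ball /= sub0r normrN gtr0_norm //; lra.
move=> /hp; rewrite /g.
have -> : x - (p + s *: (x - p)) = (1 - s) *: (x - p).
  by rewrite scalerBl scale1r opprD addrA.
rewrite enormZ ger0_norm; last lra.
have : 0 < enorm (x - p) by rewrite enorm_gt0 subr_eq0.
nra.
Qed.

End EuclideanTheory.

(** * Closedness, boundary and projections of the exponential cone *)

Section ExponentialConeGeometry.
Variable R : realType.
Implicit Types (z v w u : 'rV[R]_3) (beta t : R).

Lemma dotp3E v w : dotp v w = v 0 0 * w 0 0 + v 0 1 * w 0 1 + v 0 2 * w 0 2.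
Proof.
rewrite /dotp !big_ord_recr big_ord0 /= add0r.
by congr (v _ _ * w _ _ + v _ _ * w _ _ + v _ _ * w _ _); exact: val_inj.
Qed.

Lemma vec3E0 (a b c : R) : vec3 a b c 0 0 = a. Proof. by rewrite mxE. Qed.
Lemma vec3E1 (a b c : R) : vec3 a b c 0 1 = b. Proof. by rewrite mxE. Qed.
Lemma vec3E2 (a b c : R) : vec3 a b c 0 2 = c. Proof. by rewrite mxE. Qed.

Definition vec3E := (vec3E0, vec3E1, vec3E2).

(* The inequalities are the tangent planes of the surface z = y e^(x/y). *)
Lemma Kexp_halfspaces v : Kexp R v <->
  0 <= v 0 1 /\ forall s, expR s * (v 0 0 + (1 - s) * v 0 1) <= v 0 2.
Proof.
split => [[[y0 hz]|[x0 z0 y0]]|[y0 h]].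
- split=> [|s]; first exact: ltW.
  apply: le_trans hz.
  have -> : v 0 0 = v 0 0 / v 0 1 * v 0 1 by rewrite divfK // gt_eqF.
  set a := v 0 0 / v 0 1; have -> : a * v 0 1 / v 0 1 = a by rewrite mulfK // gt_eqF.
  rewrite -mulrDl mulrA (mulrC (v 0 1)) ler_pM2r //.
  have -> : expR a = expR s * expR (a - s) by rewrite -expRD addrC subrK.
  rewrite ler_pM2l ?expR_gt0 //; have := expR_ge1Dx (a - s); lra.
- rewrite y0; split=> // s; apply: le_trans z0.
  by rewrite mulr0 addr0 mulr_ge0_le0 // expR_ge0.
- have [y1|y1] := eqVneq (v 0 1) 0; last first.
    have {y0 y1} y0 : 0 < v 0 1 by rewrite lt0r y1.
    (* The tangent plane at s = x/y touches the surface at (x, y), so it gives back the defining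
       inequality. *)
    left; split => //; apply: le_trans (h (v 0 0 / v 0 1)).
    by rewrite mulrBl mul1r divfK ?gt_eqF // addrC subrK mulrC.
  right; split => //.
    have hs s : expR s * v 0 0 <= v 0 2 by have := h s; rewrite y1 mulr0 addr0.
    rewrite leNgt; apply/negP => x0.
    (* If x > 0, then s = z/x gives e^s x >= x + z > z. *)
    have := hs (v 0 2 / v 0 0); have := expR_ge1Dx (v 0 2 / v 0 0).
    rewrite -(ler_pM2r x0) mulrDl mul1r divfK ?gt_eqF //; lra.
  rewrite leNgt; apply/negP => z0.
  have hs s : expR s * v 0 0 <= v 0 2 by have := h s; rewrite y1 mulr0 addr0.
  have x0 : v 0 0 < 0 by have := hs 0; rewrite expR0; lra.
  (* With x and z negative, choosing e^s = z/(2x) yields z/2 <= z, which is absurd. *)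
  pose r := v 0 2 / v 0 0 / 2.
  have r0 : 0 < r by rewrite divr_gt0 // nmulr_rgt0 // invr_lt0.
  have [s hr] := expR_total r0.
  have := hs s; rewrite hr /r mulrAC divfK ?lt_eqF //; lra.
Qed.

Lemma closed_Kexp : closed (Kexp R).
Proof.
have -> : Kexp R = [set v | 0 <= v 0 1] `&`
   \bigcap_(s in [set: R]) [set v | expR s * (v 0 0 + (1 - s) * v 0 1) - v 0 2 <= 0].
  apply/seteqP; split => v.
    by move=> /Kexp_halfspaces[? h]; split => // s _ /=; rewrite subr_le0.
  by move=> [? h]; apply/Kexp_halfspaces; split => // s; rewrite -subr_le0; exact: (h s).
have cc (i : 'I_3) : continuous (fun v : 'rV[R]_3 => v 0 i) by exact: coord_continuous.
apply: closedI.
  by apply: (preimage_closed _ (@closed_ge _ 0)) => v _; exact: cc.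
apply: closed_bigI => s _; apply: (preimage_closed _ (@closed_le _ 0)) => v _.
have gc : {for v, continuous
    (fun v : 'rV[R]_3 => expR s * (v 0 0 + (1 - s) * v 0 1) - v 0 2)}.
  apply: continuousB; last exact: cc.
  apply: continuousM; first exact: cst_continuous.
  apply: continuousD; first exact: cc.
  by apply: continuousM; [exact: cst_continuous|exact: cc].
exact: gc.
Qed.

Lemma Kexp_scale (a : R) v : 0 <= a -> Kexp R v -> Kexp R (a *: v).
Proof.
move=> a0 /Kexp_halfspaces[y0 h]; apply/Kexp_halfspaces; rewrite !mxE.
split=> [|s]; first exact: mulr_ge0.
by rewrite mulrCA -mulrDr mulrCA ler_wpM2l.
Qed.

Lemma Kexp0 : Kexp R 0.
Proof. by right; rewrite !mxE. Qed.

(** Where y > 0, the strict inequality z > y e^(x/y) is an open condition, so it cannot hold at a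
    boundary point. *)
Lemma boundary_Kexp v : boundary (Kexp R) v ->
  [/\ v 0 0 <= 0, 0 <= v 0 2 & v 0 1 = 0] \/
  (0 < v 0 1 /\ v 0 2 = v 0 1 * expR (v 0 0 / v 0 1)).
Proof.
move=> [/closed_Kexp Kv nint]; case: (Kv) => [[y0 hz]|[*]]; [right|by left].
split=> //; apply/eqP; rewrite eq_le hz andbT leNgt; apply/negP => lt_z; apply: nint.
have cc (i : 'I_3) : continuous (fun u : 'rV[R]_3 => u 0 i) by exact: coord_continuous.
have gc : {for v, continuous (fun u : 'rV[R]_3 => u 0 2 - u 0 1 * expR (u 0 0 / u 0 1))}.
  apply: continuousB; first exact: cc.
  apply: continuousM; first exact: cc.
  apply: continuous_comp; last exact: continuous_expR.
  apply: continuousM; first exact: cc.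
  by apply: continuousV; [rewrite gt_eqF|exact: cc].
have y_near : nbhs v [set u : 'rV[R]_3 | 0 < u 0 1] by exact: (cvgr_gt _ (cc 1 v)).
have z_near : nbhs v [set u : 'rV[R]_3 | 0 < u 0 2 - u 0 1 * expR (u 0 0 / u 0 1)].
  by apply: (cvgr_gt _ gc); rewrite subr_gt0.
apply: filterS2 y_near z_near => u /= u1 u2; left; split => //.
by rewrite -subr_ge0 ltW.
Qed.

(** Optimality along the segment from v to the apex gives <v,v> <= <v,q>, and Cauchy-Schwarz
    concludes. This keeps projections of points of B(t) inside B(t). *)
Lemma is_proj_Kexp_norm q v : is_proj (Kexp R) q v -> enorm v <= enorm q.
Proof.
move=> [Kv hv].
suff vq : dotp v v <= dotp v q.
  have [->|v0] := eqVneq (enorm v) 0; first exact: enorm_ge0.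
  have {v0} v0 : 0 < enorm v by rewrite lt0r v0 enorm_ge0.
  rewrite -(ler_pM2l v0) -expr2 enorm_sqr (le_trans vq) //.
  by apply: le_trans (dotp_abs_le _ _); rewrite ler_norm.
(* compare v with the points (1 - s) v of the cone *)
have h s : 0 < s -> s <= 1 -> 0 <= 2 * (dotp v q - dotp v v) + s * dotp v v.
  move=> s0 s1; have Ks : Kexp R ((1 - s) *: v) by apply: Kexp_scale => //; lra.
  have := hv _ Ks; rewrite enorm_le ?enorm_ge0 // enorm_sqr.
  rewrite !(dotpDl, dotpDr, dotpNl, dotpNr, dotpZl, dotpZr) (dotpC q v) => {}h.
  rewrite -(pmulr_rge0 _ s0); nra.
rewrite leNgt; apply/negP => lt_vq.
have vv : 0 <= dotp v v by exact: dotp_ge0.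
(* With d = <v,v> - <v,q> > 0, this s = d / (<v,v> + d) satisfies s <v,v> < d, against 2d <= s <v,v>
   from [h]. *)
pose s := (dotp v v - dotp v q) / (dotp v v + (dotp v v - dotp v q)).
have den : 0 < dotp v v + (dotp v v - dotp v q) by lra.
have s0 : 0 < s by rewrite divr_gt0 //; lra.
have s1 : s <= 1 by rewrite ler_pdivrMr //; lra.
have := h s s0 s1.
have : s * (dotp v v + (dotp v v - dotp v q)) = dotp v v - dotp v q by rewrite divfK // gt_eqF.
nra.
Qed.

End ExponentialConeGeometry.

(** * Exponential inequalities and growth of the boundary away from the ray *)

Section HolderGrowth.
Variable R : realType.
Implicit Types (z v w u : 'rV[R]_3) (beta t h : R).

(* 1 + x <= e^x at x = h / 2 *)
Lemma expR_half_sqr h : (expR (h / 2) - 1) ^+ 2 <= expR h - 1 - h.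
Proof.
have -> : expR h = expR (h / 2) ^+ 2 by rewrite -expRM_natl mulrC divfK.
have := expR_ge1Dx (h / 2); lra.
Qed.

(** With F = e^(h/2), factor e^h - 1 = (F + 1)(F - 1) and use (F + 1)^2 <= 2 (1 + F^2). *)
Lemma expR_sub1_sqr h : (expR h - 1) ^+ 2 <= 2 * (1 + expR h) * (expR h - 1 - h).
Proof.
apply: le_trans (_ : 2 * (1 + expR h) * (expR (h / 2) - 1) ^+ 2 <= _); last first.
  rewrite ler_wpM2l ?expR_half_sqr // mulr_ge0 // addr_ge0 //; exact: expR_ge0.
have -> : expR h = expR (h / 2) ^+ 2 by rewrite -expRM_natl mulrC divfK.
set F := expR _.
have -> : (F ^+ 2 - 1) ^+ 2 = (F + 1) ^+ 2 * (F - 1) ^+ 2 by ring.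
rewrite ler_wpM2r ?sqr_ge0 //; have := sqr_ge0 (F - 1); lra.
Qed.

(** The gap e^h - 1 - h is quadratic near 0 but only linear as h tends to -oo; the factor 1 + |h|
    compensates. *)
Lemma sqr_le_expR_gap h : h ^+ 2 <= 16 * (1 + `|h|) * (expR h - 1 - h).
Proof.
have e1 := expR_ge1Dx h.
have [h0|h0] := leP 0 h.
  rewrite ger0_norm //; have := expR_half_sqr h; have := expR_ge1Dx (h / 2).
  set F := expR (h / 2) => hF hG.
  have : h ^+ 2 / 4 <= (F - 1) ^+ 2 by nra.
  nra.
rewrite ltr0_norm //; have [h2|h2] := leP h (-2).
  (* For h <= -2 the gap exceeds -1 - h >= -h/2. *)
  have := expR_gt0 h; nra.
(* For -2 < h < 0, F <= 1/(1 - h/2) with 1 - h/2 < 2, so 1 - F >= -h/4; this is the source of the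
   constant 16. *)
have := expR_half_sqr h; have := expR_ge1Dx (- (h / 2)).
have FN : expR (- (h / 2)) * expR (h / 2) = 1 by rewrite mulrC expRxMexpNx_1.
have := expR_gt0 (h / 2).
set F := expR (h / 2) in FN *; set G := expR (- (h / 2)) in FN * => F0 hG hF.
have : (1 - h / 2) * F <= G * F by rewrite ler_wpM2r // ltW.
rewrite FN => hF1.
have : - h / 4 <= 1 - F by nra.
move=> hF2; have : h ^+ 2 / 16 <= (F - 1) ^+ 2 by nra.
nra.
Qed.

(** The pairing of z with (s, 1, e^s) is a nonnegative convex function of s with a zero at 1 - beta.
    Its value and derivative both vanish there, which gives the two equations. *)
Lemma exposing_normal beta z : dual_cone (Kexp R) z -> z 0 0 < 0 ->
  dotp (vec3 (1 - beta) 1 (expR (1 - beta))) z = 0 ->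
  z 0 1 = beta * z 0 0 /\ z 0 2 = - z 0 0 * expR (beta - 1).
Proof.
move=> hz a0; rewrite dotp3E !vec3E mul1r => eq0.
set a := z 0 0 in a0 eq0 *; set b := z 0 1 in eq0 *; set c := z 0 2 in eq0 *.
have hs s : 0 <= s * a + b + expR s * c.
  have := hz (vec3 s 1 (expR s)); rewrite dotp3E !vec3E mul1r; apply.
  by left; rewrite !vec3E divr1 mul1r.
have c0 : 0 < c.
  have c0 : 0 <= c.
    have := hz (vec3 0 0 1); rewrite dotp3E !vec3E !mul0r !add0r mul1r; apply.
    by right; rewrite !vec3E.
  rewrite lt0r c0 andbT; apply/negP => /eqP c00.
  (* If c = 0, this s makes the pairing equal to -1. *)
  by have := hs ((- 1 - b) / a); rewrite c00 mulr0 divfK ?lt_eqF //; lra.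
(* s minimises s a + b + e^s c; strict convexity makes it the only minimiser *)
have [s es] : exists s, expR s = - a / c by apply: expR_total; rewrite divr_gt0 // oppr_gt0.
have esc : expR s * c = - a by rewrite es divfK // gt_eqF.
have s_eq : s = 1 - beta.
  apply/eqP; rewrite eq_sym -subr_eq0; apply/negPn/negP => /expR_gt1Dx.
  set h := 1 - beta - s => hlt; have := hs s.
  have e1 : expR (1 - beta) * c = expR h * (- a) by rewrite -esc mulrA -expRD subrK.
  rewrite e1 in eq0; rewrite esc /h in hlt *; nra.
have e2 : expR (1 - beta) * c = - a by rewrite -s_eq.
split; first by lra.
by rewrite -e2 mulrAC -expRD addrA subrK addrN expR0 mul1r.
Qed.

(** With q = e^(1 - beta), the three terms times t bound 16 (y + y |h|), 2 q^2 y and 2 q^2 y e^h on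
    B(t). *)
Definition growth_const beta : R :=
  16 * (2 + `|1 - beta|) + 2 * expR (1 - beta) ^+ 2 + 2 * expR (1 - beta).

(** By [exposing_normal] the last factor is <v,z> / (-z_x), so this is a Hölder bound of exponent
    1/2 for the distance to the ray. *)
Lemma Kexp_boundary_growth beta t v : boundary (Kexp R) v -> enorm v <= t ->
  exists2 p, Fbeta beta p & dotp (v - p) (v - p) <=
    growth_const beta * t * (- v 0 0 - beta * v 0 1 + expR (beta - 1) * v 0 2).
Proof.
move=> /boundary_Kexp bv vt.
have ct (i : 'I_3) : `|v 0 i| <= t by exact: le_trans (coord_le_enorm _ _) vt.
have t0 : 0 <= t by exact: le_trans (enorm_ge0 _) vt.
set q := expR (1 - beta).
have q0 : 0 < q by exact: expR_gt0.
have qN : expR (beta - 1) * q = 1 by rewrite -expRD addrA subrK addrN expR0.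
set r := expR (beta - 1) in qN *.
have r0 : 0 < r by exact: expR_gt0.
have n0 : 0 <= `|1 - beta| by [].
case: bv => [[x0 z0 y0]|[y0 z_eq]].
  (* On the flat part y = 0 the apex suffices: x^2 + z^2 <= t (-x + z), and [growth_const] dominates
     both 1 and q. *)
  exists 0.
    exists 0 => //=; apply/rowP => i; rewrite /vec3 !mulr0 add0r !mxE.
    by case: i => -[|[|[]]].
  rewrite subr0 dotp3E y0 !mulr0 addr0 subr0.
  have := ct 0; rewrite ler0_norm // => xt; have := ct 2; rewrite ger0_norm // => zt.
  apply: le_trans (_ : t * (- v 0 0 + v 0 2) <= _); first nra.
  rewrite -mulrA mulrCA ler_wpM2l // mulrDr; apply: lerD.
    rewrite ler_peMl ?oppr_ge0 // /growth_const -/q; have := sqr_ge0 q; lra.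
  apply: le_trans (_ : q * (r * v 0 2) <= _).
    by rewrite mulrA (mulrC q) qN mul1r.
  rewrite ler_wpM2r //; first by rewrite mulr_ge0 // ltW.
  rewrite /growth_const -/q; have := sqr_ge0 q; lra.
(* With h = x / y - (1 - beta), the pairing of v with the normal is
   y (e^h - 1 - h); v is compared with the point of the ray at the same y. *)
set y := v 0 1 in y0 z_eq *; set x := v 0 0 in z_eq *.
pose h := x / y - (1 - beta).
have x_eq : x = y * (h + (1 - beta)) by rewrite /h subrK mulrC divfK // gt_eqF.
have E_eq : expR (x / y) = q * expR h by rewrite -expRD /h addrC subrK.
have z_eq' : v 0 2 = y * q * expR h by rewrite z_eq E_eq mulrA.
exists (vec3 (- beta * y + y) y (q * y)); first by exists y => //=; exact: ltW.
have gap0 : 0 <= expR h - 1 - h by have := expR_ge1Dx h; lra.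
have -> : - x - beta * y + r * v 0 2 = y * (expR h - 1 - h).
  rewrite z_eq' x_eq; have -> : r * (y * q * expR h) = r * q * y * expR h by ring.
  rewrite qN; ring.
rewrite dotp3E !mxE /= -/x -/y z_eq'.
have -> : (x - (- beta * y + y)) * (x - (- beta * y + y)) + (y - y) * (y - y) +
    (y * q * expR h - q * y) * (y * q * expR h - q * y) =
    y ^+ 2 * (h ^+ 2 + q ^+ 2 * (expR h - 1) ^+ 2) by rewrite x_eq; ring.
have h1 := sqr_le_expR_gap h; have h2 := expR_sub1_sqr h.
have yt : y <= t by have := ct 1; rewrite gtr0_norm.
have yht : y * `|h| <= t * (1 + `|1 - beta|).
  have -> : y * `|h| = `|x - y * (1 - beta)|.
    by rewrite x_eq mulrDr addrK normrM gtr0_norm.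
  apply: le_trans (ler_normB _ _) _; rewrite [leRHS]mulrDr mulr1 lerD //; first exact: (ct 0).
  by rewrite normrM gtr0_norm // ler_wpM2r.
have yet : q * (y * expR h) <= t.
  have := ct 2; rewrite z_eq' ger0_norm; first by rewrite (mulrC y q) mulrA.
  by rewrite !mulr_ge0 ?expR_ge0 // ltW.
apply: le_trans (_ : y ^+ 2 * ((16 * (1 + `|h|) + 2 * q ^+ 2 * (1 + expR h)) *
    (expR h - 1 - h)) <= _).
  rewrite ler_wpM2l ?sqr_ge0 // mulrDl lerD //.
  apply: le_trans (_ : q ^+ 2 * (2 * (1 + expR h) * (expR h - 1 - h)) <= _).
    by rewrite ler_wpM2l ?sqr_ge0.
  by rewrite le_eqVlt; apply/orP; left; apply/eqP; ring.
(* Each bracket takes one factor y: h itself is not bounded on B(t), but y |h| and y e^h are. *)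
have -> : forall A B : R, y ^+ 2 * (A * B) = (y * A) * (y * B) by move=> *; ring.
rewrite ler_wpM2r //; first by rewrite mulr_ge0 // ltW.
have -> : y * (16 * (1 + `|h|) + 2 * q ^+ 2 * (1 + expR h)) =
  16 * (y + y * `|h|) + 2 * q ^+ 2 * y + 2 * q * (q * (y * expR h)) by ring.
have a1 : q ^+ 2 * y <= q ^+ 2 * t by rewrite ler_wpM2l ?sqr_ge0.
have a2 : q * (q * (y * expR h)) <= q * t by rewrite ler_wpM2l // ltW.
rewrite /growth_const -/q; lra.
Qed.

End HolderGrowth.

(** * Positivity of gamma, finiteness of kappa and the error bound on the hyperplane *)

Section FacialResidual.
Variable R : realType.
Implicit Types (z v w u q x : 'rV[R]_3) (beta t e d : R).

Lemma perp0 z : perp z 0.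
Proof. by rewrite /perp /= -(scale0r z) dotpZl mul0r. Qed.

(** For p on the ray near v, |w - u| <= |w - v| + |v - p|, and both squares on the right are at most
    a constant times |w - v|. *)
Lemma gamma_ge beta z t : dual_cone (Kexp R) z -> z 0 0 < 0 ->
  Fbeta beta = perp z `&` Kexp R -> 0 <= t ->
  exists2 c : R, 0 < c & (c%:E <= gamma beta z t)%E.
Proof.
move=> hz a0 hF t0.
have [z1 z2] : z 0 1 = beta * z 0 0 /\ z 0 2 = - z 0 0 * expR (beta - 1).
  apply: exposing_normal => //.
  have : Fbeta beta (vec3 (1 - beta) 1 (expR (1 - beta))).
    by exists 1 => //=; rewrite !mulr1 addrC.
  by rewrite hF => -[].
set a := z 0 0 in a0 z1 z2.
have g0 : 0 <= growth_const beta.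
  rewrite /growth_const; have := expR_ge0 (1 - beta).
  by have := normr_ge0 (1 - beta); have := sqr_ge0 (expR (1 - beta)); lra.
(* Chosen so that |w - u|^2 <= C |w - v|; the summand 1 keeps C positive at t = 0. *)
pose C := 2 * t * (1 + growth_const beta * (enorm z / - a)) + 1.
have C0 : 0 < C.
  have n0 : 0 <= enorm z / - a by rewrite divr_ge0 ?enorm_ge0 // oppr_ge0 ltW.
  by rewrite ltr_wpDl // mulr_ge0 ?mulr_ge0 // addr_ge0 // mulr_ge0.
exists (Num.sqrt C)^-1; first by rewrite invr_gt0 sqrtr_gt0.
apply: le_ereal_inf_tmp => _ [v [w [u [[[bv /= vt] nFv] [wz hw] [Fu hu] wu ->]]]].
have wu0 : 0 < enorm (w - u) by rewrite enorm_gt0 subr_eq0.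
rewrite lee_fin ler_pdivlMr // mulrC ler_pdivrMr ?sqrtr_gt0 // -sqrtrM ?enorm_ge0 //.
rewrite -[leLHS](ger0_norm (enorm_ge0 _)) -sqrtr_sqr ler_sqrt; last first.
  by rewrite mulr_ge0 ?enorm_ge0 // ltW.
have [p Fp hp] := Kexp_boundary_growth beta bv vt.
set D := - v 0 0 - _ + _ in hp.
set s := enorm (w - v).
have s0 : 0 <= s by exact: enorm_ge0.
have st : s <= t.
  by rewrite /s enorm_distC (le_trans (hw _ (perp0 z))) // subr0.
(* D times -z_x is <v,z>, which equals <v - w,z> because w is orthogonal to z. *)
have Ds : D <= s * (enorm z / - a).
  rewrite mulrA ler_pdivlMr ?oppr_gt0 //.
  have -> : D * - a = dotp (v - w) z.
    by rewrite dotpDl dotpNl wz subr0 dotp3E z1 z2 -/a /D; ring.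
  by rewrite /s enorm_distC (le_trans (ler_norm _)) // dotp_abs_le.
have vp : enorm (v - p) ^+ 2 <= growth_const beta * t * (s * (enorm z / - a)).
  by rewrite enorm_sqr (le_trans hp) // ler_wpM2l // mulr_ge0.
have wu_le : enorm (w - u) <= s + enorm (v - p).
  by rewrite (le_trans (hu _ Fp)) // (le_trans (ler_enorm_dist v _ _)).
have := enorm_ge0 (v - p); move: (enorm (v - p)) vp wu_le => b vp wu_le b0.
apply: le_trans (_ : 2 * s ^+ 2 + 2 * b ^+ 2 <= _).
  have : enorm (w - u) ^+ 2 <= (s + b) ^+ 2 by rewrite ler_pXn2r ?nnegrE ?enorm_ge0 ?addr_ge0.
  have := sqr_ge0 (s - b); lra.
have : s ^+ 2 <= t * s by rewrite expr2 ler_wpM2r.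
have -> : s * C = 2 * (t * s) + 2 * (growth_const beta * t * (s * (enorm z / - a))) + s.
  by rewrite /C; ring.
lra.
Qed.

Lemma gamma_anti beta z t1 t2 : t1 <= t2 -> (gamma beta z t2 <= gamma beta z t1)%E.
Proof.
move=> t12; apply: ereal_inf_le_tmp => _ [v [w [u [[[bv /= vt] nFv] pw pu wu ->]]]].
exists v, w, u; split => //; split => //; split => //=; exact: le_trans vt t12.
Qed.

(** The value to exclude is gamma = 0, whose inverse is +oo; gamma = +oo merely contributes 0. *)
Lemma kappa_fin beta z t : dual_cone (Kexp R) z -> z 0 0 < 0 ->
  Fbeta beta = perp z `&` Kexp R -> 0 <= t -> kappa beta z t \is a fin_num.
Proof.
move=> hz a0 hF t0; have [c c0 cg] := gamma_ge hz a0 hF t0.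
have g0 : (0 <= gamma beta z t)%E by apply: le_trans cg; rewrite lee_fin ltW.
have : ((gamma beta z t)^-1 <= c^-1%:E)%E.
  have -> : c^-1%:E = (c%:E)^-1%E by rewrite inver gt_eqF.
  by rewrite lee_pV2 // inE // lee_fin ltW.
have : (0 <= (gamma beta z t)^-1)%E by rewrite inve_ge0.
rewrite /kappa; case: (_^-1)%E => [r| |] //= _ _.
by rewrite -EFinM -EFin_max.
Qed.

Lemma fine_kappa_sqrt beta z t : kappa beta z t \is a fin_num ->
  2 * Num.sqrt t <= fine (kappa beta z t).
Proof. by move=> kfin; rewrite -lee_fin fineK // /kappa le_max lexx. Qed.

Lemma fine_kappa_ge0 beta z t : kappa beta z t \is a fin_num -> 0 <= fine (kappa beta z t).
Proof. by move=> /fine_kappa_sqrt; apply: le_trans; rewrite mulr_ge0 ?sqrtr_ge0. Qed.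

Lemma kappa_homo beta z t1 t2 : dual_cone (Kexp R) z -> z 0 0 < 0 ->
  Fbeta beta = perp z `&` Kexp R -> 0 <= t1 -> t1 <= t2 ->
  fine (kappa beta z t1) <= fine (kappa beta z t2).
Proof.
move=> hz a0 hF t10 t12; have t20 := le_trans t10 t12.
have g0 t : 0 <= t -> (0 <= gamma beta z t)%E.
  move=> t0; have [c c0 cg] := gamma_ge hz a0 hF t0.
  by apply: le_trans cg; rewrite lee_fin ltW.
apply: fine_le; rewrite ?kappa_fin // /kappa ge_max; apply/andP; split.
  by rewrite le_max lee_fin ler_pM2l // ler_wsqrtr.
rewrite le_max; apply/orP; right; apply: lee_pmul => //.
  by rewrite inve_ge0 g0.
by rewrite lee_pV2 ?inE ?g0 // gamma_anti.
Qed.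

Definition perp_proj z v := v - (dotp v z / dotp z z) *: z.

Lemma perp_proj_in z v : z != 0 -> perp z (perp_proj z v).
Proof.
move=> z0; rewrite /perp /= dotpDl dotpNl dotpZl divfK ?subrr // dotp_eq0 //.
Qed.

(** Pythagoras: y - v splits into a vector of the hyperplane and a multiple of z. *)
Lemma perp_proj_le z v y : z != 0 -> perp z y ->
  enorm (y - perp_proj z v) <= enorm (y - v).
Proof.
move=> z0 zy; rewrite enorm_le ?enorm_ge0 // enorm_sqr.
have -> : y - v = (y - perp_proj z v) + (perp_proj z v - v) by rewrite subrKA.
have -> : perp_proj z v - v = - (dotp v z / dotp z z) *: z by rewrite addrAC subrr add0r scaleNr.
have : dotp (y - perp_proj z v) z = 0 by rewrite dotpDl dotpNl zy (perp_proj_in v z0) subrr.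
move: (y - _) => p pz.
rewrite !(dotpDl, dotpDr, dotpZl, dotpZr) (dotpC z p) pz !mulr0 addr0 add0r lerDl.
by rewrite mulrA mulr_ge0 ?dotp_ge0 // -expr2 sqr_ge0.
Qed.

Lemma perp_proj_dist z v : z != 0 -> enorm (v - perp_proj z v) = `|dotp v z| / enorm z.
Proof.
move=> z0; rewrite opprB addrCA subrr addr0 enormZ normrM normfV (ger0_norm (dotp_ge0 _)).
by rewrite -enorm_sqr -mulrA; congr (_ * _); rewrite expr2 invfM divfK // enorm_eq0.
Qed.

Lemma is_proj_perp z v : z != 0 -> is_proj (perp z) v (perp_proj z v).
Proof.
move=> z0; split; first exact: perp_proj_in.
move=> y zy; rewrite perp_proj_dist // ler_pdivrMr ?enorm_gt0 //.
have -> : dotp v z = dotp (v - y) z by rewrite dotpDl dotpNl zy subr0.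
exact: dotp_abs_le.
Qed.

(** Each entry of the maximum [kappa] pays for half of the bound: 2 t^(1/2) for |q - w| and 2
    gamma^-1 for |w - u|. The configurations left out of the infimum are settled first. *)
Lemma perp_error_bound beta z t q k d : dual_cone (Kexp R) z -> z 0 0 < 0 ->
  Fbeta beta = perp z `&` Kexp R -> closed (Fbeta beta) -> 0 <= t ->
  perp z q -> enorm q <= t -> Kexp R k -> enorm (q - k) <= d ->
  exists2 p, Fbeta beta p & enorm (q - p) <= fine (kappa beta z t) * Num.sqrt d.
Proof.
move=> hz a0 hF Fcl t0 zq qt Kk qk.
have kfin : kappa beta z t \is a fin_num by exact: kappa_fin.
have z0 : z != 0 by apply: contraTneq a0 => ->; rewrite mxE ltxx.
have [Kq|nKq] := pselect (Kexp R q).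
  exists q; first by rewrite hF.
  have -> : enorm (q - q) = 0 by apply/eqP; rewrite enorm_eq0 subrr.
  by rewrite mulr_ge0 ?sqrtr_ge0 // fine_kappa_ge0.
have [v pv] : exists v, is_proj (Kexp R) q v.
  by apply: nearest_point; [exact: closed_Kexp|exists 0; exact: Kexp0].
have bv := is_proj_boundary pv nKq.
have vt : enorm v <= t by exact: le_trans (is_proj_Kexp_norm pv) qt.
case: pv => Kv hv; set D := enorm (q - v).
have D0 : 0 <= D by exact: enorm_ge0.
have Dd : D <= d by exact: le_trans (hv _ Kk) qk.
have Dt : D <= t by rewrite (le_trans (hv _ (Kexp0 R))) // subr0.
have half_le : 2 * D <= fine (kappa beta z t) * Num.sqrt d.
  apply: le_trans (_ : (2 * Num.sqrt t) * Num.sqrt d <= _); last first.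
    by rewrite ler_wpM2r ?sqrtr_ge0 // fine_kappa_sqrt.
  (* Split D as a product of two square roots, one bounded through D <= t and the other through D <=
     d. *)
  rewrite -{1}(sqr_sqrtr D0) expr2 mulrA ler_pM ?mulr_ge0 ?sqrtr_ge0 //.
    by rewrite ler_pM2l // ler_wsqrtr.
  by rewrite ler_wsqrtr.
have full_le : D <= fine (kappa beta z t) * Num.sqrt d by lra.
have [Fv|nFv] := pselect (Fbeta beta v); first by exists v.
set w := perp_proj z v.
have qw : enorm (q - w) <= D by exact: perp_proj_le.
have pw := is_proj_perp v z0; rewrite -/w in pw.
have [u pu] : exists u, is_proj (Fbeta beta) w u.
  by apply: nearest_point => //; exists 0; rewrite hF; split; [exact: perp0|exact: Kexp0].
have [wu|wu] := eqVneq w u.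
  by exists w; [rewrite wu; case: pu|exact: le_trans qw full_le].
exists u; first by case: pu.
have gle : (gamma beta z t <= (Num.sqrt (enorm (w - v)) / enorm (w - u))%:E)%E.
  by apply: ereal_inf_lbound; exists v, w, u; split.
have [c c0 cg] := gamma_ge hz a0 hF t0.
have wu0 : 0 < enorm (w - u) by rewrite enorm_gt0 subr_eq0.
(* If w = v the quotient would be 0, below the positive lower bound c of gamma. *)
have wv0 : 0 < Num.sqrt (enorm (w - v)).
  have := lt_le_trans (_ : (0 < c%:E)%E) (le_trans cg gle); rewrite !lte_fin => /(_ c0).
  by rewrite pmulr_lgt0 // invr_gt0.
have kge : 2 * (enorm (w - u) / Num.sqrt (enorm (w - v))) <= fine (kappa beta z t).
  rewrite -lee_fin fineK // /kappa le_max; apply/orP; right; rewrite EFinM.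
  apply: lee_wpmul2l => //.
  have -> : (enorm (w - u) / Num.sqrt (enorm (w - v)))%:E =
      ((Num.sqrt (enorm (w - v)) / enorm (w - u))%:E^-1)%E.
    by rewrite inver gt_eqF ?divr_gt0 // invf_div.
  rewrite lee_pV2 ?inE // ?lee_fin ?divr_ge0 ?sqrtr_ge0 ?enorm_ge0 //.
  by apply: le_trans cg; rewrite lee_fin ltW.
have wvD : enorm (w - v) <= D by rewrite enorm_distC /D (enorm_distC q); case: pw => _; exact.
have : 2 * enorm (w - u) <= fine (kappa beta z t) * Num.sqrt d.
  apply: le_trans (_ : fine (kappa beta z t) * Num.sqrt (enorm (w - v)) <= _).
    by rewrite -ler_pdivrMr // -mulrA.
  rewrite ler_wpM2l ?fine_kappa_ge0 // ler_wsqrtr //; exact: le_trans wvD Dd.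
have := ler_enorm_dist w q u; lra.
Qed.

End FacialResidual.

(** * The one-step facial residual functions *)

Theorem corollary4p7 (R : realType) (beta : R) (z : 'rV[R]_3)
  (hz : dual_cone (Kexp R) z) (hzx : z 0 0 < 0)
  (hF : Fbeta beta = perp z `&` Kexp R)
  (hface : is_face (Kexp R) (Fbeta beta))
  (hdim : has_dim (Fbeta beta) 1) :
  [/\ forall t : R, 0 <= t -> kappa beta z t \is a fin_num,
      one_step_FRF (Kexp R) z (psiK beta z)
    & exists (k : R) (rho : R -> R),
        [/\ 0 < k,
            forall t, 0 <= t -> 0 <= rho t,
            forall t1 t2, 0 <= t1 -> t1 <= t2 -> rho t1 <= rho t2
          & one_step_FRF (Kexp R) z (fun e t => k * e + rho t * Num.sqrt e)]].
Proof.
have kfin t : 0 <= t -> kappa beta z t \is a fin_num by exact: kappa_fin.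
have k0 t : 0 <= t -> 0 <= fine (kappa beta z t) by move=> t0; apply/fine_kappa_ge0/kfin.
have kmono t1 t2 : 0 <= t1 -> t1 <= t2 -> fine (kappa beta z t1) <= fine (kappa beta z t2).
  exact: kappa_homo.
have Fcl : closed (Fbeta beta) by case: hface => -[].
have z0 : 0 < enorm z by rewrite enorm_gt0; apply: contraTneq hzx => ->; rewrite mxE ltxx.
(* For e >= 0, max(e, e/|z|) = k e, so [psiK] itself has the form k e + rho(t) sqrt(e); one
   verification serves both claims. *)
pose k := Num.max 1 (enorm z)^-1.
have kge1 : 1 <= k by rewrite le_max lexx.
have k_ge0 : 0 <= k by lra.
pose rho t := fine (kappa beta z t) * Num.sqrt (1 + k).
have psiE e t : 0 <= e -> psiK beta z e t = k * e + rho t * Num.sqrt e.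
  move=> e0; have maxE : Num.max e (e / enorm z) = k * e by rewrite maxr_pMl // mul1r mulrC.
  have -> : rho t * Num.sqrt e = fine (kappa beta z t) * Num.sqrt (e + k * e).
    by rewrite -mulrA -sqrtrM ?addr_ge0 // mulrDl mul1r.
  by rewrite /psiK maxE.
have rho0 t : 0 <= t -> 0 <= rho t by move=> t0; rewrite mulr_ge0 ?sqrtr_ge0 ?k0.
have rho_mono t1 t2 : 0 <= t1 -> t1 <= t2 -> rho t1 <= rho t2.
  by move=> t10 t12; rewrite ler_wpM2r ?sqrtr_ge0 // kmono.
have FRF : one_step_FRF (Kexp R) z (fun e t => k * e + rho t * Num.sqrt e).
  split.
  - by move=> e t e0 t0; rewrite addr_ge0 // mulr_ge0 ?sqrtr_ge0 ?rho0.
  - by move=> e1 e2 t e10 e12 t0; rewrite lerD ?ler_wpM2l // ?ler_wpM2l ?rho0 // ler_wsqrtr.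
  - by move=> e t1 t2 e0 t10 t12; rewrite lerD2l ler_wpM2r ?sqrtr_ge0 // rho_mono.
  - by move=> t t0; rewrite sqrtr0 !mulr0 addr0.
  move=> x e _ e0 dxK xz; rewrite -psiE // /psiK.
  have [y [Ky hy]] : exists y, is_proj (Kexp R) x y.
    by apply: nearest_point; [exact: closed_Kexp|exists 0; exact: Kexp0].
  have xy : enorm (x - y) <= e.
    rewrite -lee_fin; apply: le_trans dxK; apply: le_ereal_inf_tmp => _ [p Kp <-].
    by rewrite lee_fin hy.
  set m := Num.max e _; set w := perp_proj z x.
  have zn0 : z != 0 by rewrite -enorm_gt0.
  (* This amounts to |<x,z>| <= m |z|. The upper side is the assumption <x,z> <= e; for the lower
     side, <y,z> >= 0 gives <x,z> >= <x - y,z> >= -e |z|. *)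
  have xw : enorm (x - w) <= m.
    rewrite perp_proj_dist // ler_pdivrMr // /m maxr_pMl ?enorm_ge0 // divfK ?gt_eqF //.
    rewrite ler_norml le_max xz orbT andbT lerNl le_max; apply/orP; left.
    have := hz _ Ky; rewrite -[y](subKr x) dotpDl dotpNl => h.
    apply: le_trans (_ : - dotp (x - y) z <= _); first lra.
    apply: le_trans (ler_norm _) _; rewrite normrN (le_trans (dotp_abs_le _ _)) //.
    by rewrite ler_wpM2r // ltW.
  have wx : enorm w <= enorm x.
    have := perp_proj_le x zn0 (perp0 z); rewrite !sub0r !enormN; exact.
  have wy : enorm (w - y) <= e + m.
    rewrite (le_trans (ler_enorm_dist x _ _)) // addrC lerD // enorm_distC //.
  (* Applied at t = |x| and d = e + m, with y as the nearby point of the cone. *)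
  have [p Fp hp] := perp_error_bound hz hzx hF Fcl (enorm_ge0 x) (perp_proj_in x zn0) wx Ky wy.
  apply: le_trans (_ : (enorm (x - p))%:E <= _)%E.
    by apply: ereal_inf_lbound; exists p => //; rewrite setIC -hF.
  by rewrite lee_fin (le_trans (ler_enorm_dist w _ _)) // lerD.
split => //; last by exists k, rho; split => //; lra.
case: FRF => h1 h2 h3 h4 h5; split.
- by move=> e t e0 t0; rewrite psiE // h1.
- by move=> e1 e2 t e10 e12 t0; rewrite !psiE ?h2 // (le_trans e10).
- by move=> e t1 t2 e0 t10 t12; rewrite !psiE // h3.
- by move=> t t0; rewrite psiE // h4.
- by move=> x e Kx e0 dx xz; rewrite psiE // h5.
Qed.
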